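(* Let $\theta=(\theta_1,\dots,\theta_N)$ be a solution of the Kuramoto system $$\dot\theta_i(t)=\Omega_i+\kappa\sum_{j\in\mathcal N_i}\sin(\theta_j(t)-\theta_i(t)),\quad t>0,\ i\in\{1,\dots,N\},\qquad \theta_i(0)=\theta_{i0},$$ on a digraph $\mathcal G$ that contains a spanning tree. Let $\alpha,\gamma$ be constants and let $\eta$ be a real number such that $$D(\theta(0))<\alpha<\gamma<\pi,\qquad \eta>\max\left\{\frac{1}{\sin\gamma},\ \frac{2}{1-\frac{\alpha}{\gamma}}\right\}.$$ Put $\beta=1-\frac{2}{\eta}$, $$c=\frac{(2N+1)\left(\sum_{j=1}^{N-1}\eta^jA(2N,j)+1\right)\gamma}{\sin\gamma},\qquad \tilde c=\frac{D(\Omega)\left(\sum_{j=1}^{N-1}\eta^jA(2N,j)+1\right)\gamma}{\sin\gamma},$$ and let $d$ be the index of the last layer in the node decomposition $\mathcal G=\bigcup_{i=0}^d\bigcup_{j=1}^{k_i}\mathcal G_i^j$ (so $d<N$). Let $D^\infty$ be a (small) constant with $0<D^\infty<\min\{\alpha,\frac{\pi}{2}\}$, and suppose that the coupling strength satisfies $$\kappa>\left(1+\frac{(d+1)\alpha}{\alpha-D(\theta(0))}\right)\frac{(4c)^d\,\tilde c}{\beta^{d+1}D^\infty}.$$ Then there exists a time $t_*$ such that $$D(\theta(t))<D^\infty\qquad\text{for all } t\in(t_*,+\infty).$$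
   Context: Setting: $\mathcal V=\{1,\dots,N\}$ is the vertex set of a digraph $\mathcal G$; $\mathcal N_i\subset\mathcal V$ is the set of neighbors of $i$, i.e. the vertices $j$ that directly influence $i$ (there is an arc from $j$ to $i$ iff $j\in\mathcal N_i$). The phases $\theta_i$ are real-valued, $\Omega_i\in\mathbb R$ are constant natural frequencies, and $\kappa>0$. Notation: $D(\theta)=\max_i\theta_i-\min_i\theta_i$, $D(\Omega)=\max_i\Omega_i-\min_i\Omega_i$, and $A(n,j)=n(n-1)\cdots(n-j+1)$ is the number of $j$-permutations of $n$ objects (empty sums are $0$). Spanning tree: a path from $i_1$ to $i_k$ is a sequence $i_1,\dots,i_k$ with $i_s\in\mathcal N_{i_{s+1}}$ for $1\le s\le k-1$; $\mathcal G$ contains a spanning tree if there is a vertex from which every other vertex is reachable by a path. Node decomposition: a set of vertices $\mathcal G_1$ is a node if it is strongly connected (for every nonempty proper subset $\mathcal G_2\subset\mathcal G_1$, some vertex of $\mathcal G_2$ has a neighbor in $\mathcal G_1\setminus\mathcal G_2$). A node $\mathcal G_1$ of a digraph $\mathcal H$ is a maximum node of $\mathcal H$ if no vertex of $\mathcal G_1$ has a neighbor in $\mathcal H\setminus\mathcal G_1$. Every digraph decomposes as $\mathcal G=\bigcup_{i=0}^d\bigcup_{j=1}^{k_i}\mathcal G_i^j$, where $\mathcal G_0^1,\dots,\mathcal G_0^{k_0}$ are the maximum nodes of $\mathcal G$ and, for $1\le p\le d$, $\mathcal G_p^1,\dots,\mathcal G_p^{k_p}$ are the maximum nodes of the induced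 subgraph on $\mathcal G\setminus\bigcup_{i=0}^{p-1}\bigcup_{j=1}^{k_i}\mathcal G_i^j$. This defines $d$. *)

(* Defs.v *)
From HB Require Import structures.
From mathcomp Require Import all_boot all_order all_algebra.
From mathcomp Require Import reals topology normedtype derive trigo.

Set Implicit Arguments.
Unset Strict Implicit.
Unset Printing Implicit Defensive.

Import Order.TTheory GRing.Theory Num.Theory.
Import numFieldNormedType.Exports.

(* A digraph on {1, ..., N} is given by its neighbor sets: [j \in nbr i] means
   that there is an arc from j to i.  Loops are not excluded. *)
Section Digraph.
Variables (N : nat) (nbr : 'I_N -> {set 'I_N}).
Implicit Types (A H : {set 'I_N}) (p d : nat).

Definition influences : rel 'I_N := fun j i => j \in nbr i.

Definition has_spanning_tree : Prop :=
  exists r : 'I_N, forall i : 'I_N, i != r ->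
    exists2 s : seq 'I_N, path influences r s & last r s = i.

Definition strongly_connected A : bool :=
  [forall B : {set 'I_N}, (B != set0) && (B \proper A) ==>
     [exists i in B, exists j in A :\: B, j \in nbr i]].

(* Vertices are required: the empty set would be strongly connected. *)
Definition is_node A : bool := (A != set0) && strongly_connected A.

(* [H] stands for the subgraph induced on the vertex set [H]. *)
Definition maximum_node H A : bool :=
  [&& A \subset H, is_node A &
      [forall i in A, forall j in H :\: A, j \notin nbr i]].

Definition maximum_nodes H : {set {set 'I_N}} := [set A | maximum_node H A].

(* What is left of the digraph once the layers 0, ..., p-1 are removed. *)
Fixpoint remainder p : {set 'I_N} :=
  if p is q.+1
  then remainder q :\: cover (maximum_nodes (remainder q))
  else [set: 'I_N].

Definition layer p : {set {set 'I_N}} := maximum_nodes (remainder p).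

Definition last_layer d : Prop :=
  (forall p, (p <= d)%N -> layer p != set0) /\
  \bigcup_(p < d.+1) cover (layer p) = [set: 'I_N].

End Digraph.

Local Open Scope classical_set_scope.
Local Open Scope ring_scope.

Section Kuramoto.
Variables (R : realType) (N : nat).
Implicit Types x : 'I_N -> R.

(* The value 0 is only taken when N = 0. *)
Definition vmax x : R :=
  if [pick i : 'I_N] is Some i0 then \big[Num.max/x i0]_(i < N) x i else 0.

Definition vmin x : R :=
  if [pick i : 'I_N] is Some i0 then \big[Num.min/x i0]_(i < N) x i else 0.

Definition diam x : R := vmax x - vmin x.

(* The equation is only required for t > 0, so the initial condition is tied to
   it by right-continuity at 0. *)
Definition kuramoto_solution (nbr : 'I_N -> {set 'I_N}) (Omega : 'I_N -> R)
    (kappa : R) (theta0 : 'I_N -> R) (theta : R -> 'I_N -> R) : Prop :=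
  [/\ forall (i : 'I_N) (t : R), 0 < t ->
        is_derive t 1 (fun s : R => theta s i)
          (Omega i + kappa * \sum_(j in nbr i) sin (theta t j - theta t i)),
      forall i : 'I_N, theta s i @[s --> 0^'+] --> theta 0 i
    & forall i : 'I_N, theta 0 i = theta0 i].

End Kuramoto.

(* Main.v *)
(* Fix a vertex [a] from which every vertex is reachable. The Lyapunov function is
   the largest value of [\sum_k w_k (theta_(f k) - theta_(g k))] over maps [f], [g]
   from ranks to vertices that repeat no vertex except possibly [a], with the
   increasing weights [w_k = eta^k A(2N, k)]. A maximizing [f] sorts the phases
   above that of [a] and sends all lower ranks to [a]. A set of vertices lying
   strictly above some level that is at least the phase of [a] does not contain
   [a], hence is influenced by its complement, so every gap between consecutive
   phases above [a] is contracted by some downward pull. The weights grow fast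
   enough for these to beat all upward pulls: the weighted drift of [f] is at
   most [- sin (max theta - theta_a)], and symmetrically below [a]. Subadditivity
   of sin then gives [Q' <= D(Omega) - kappa sin(D) / W] for the Lyapunov function
   [Q], normalized by [W = \sum_k w_k], which satisfies [beta D <= Q <= D]. *)
Require Import Defs.
From HB Require Import structures.
From mathcomp Require Import all_boot all_order all_algebra.
From mathcomp Require Import reals topology normedtype derive trigo.
From mathcomp Require Import perm boolp classical_sets ring lra zify.

Set Implicit Arguments.
Unset Strict Implicit.
Unset Printing Implicit Defensive.

Import Order.TTheory GRing.Theory Num.Theory.
Import numFieldNormedType.Exports.
Local Open Scope classical_set_scope.
Local Open Scope ring_scope.

(** * Inequalities for the sine on [0, pi] *)

Section Sine.
Variable R : realType.
Implicit Types x y g : R.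

Lemma sinD_le x y : 0 <= x -> 0 <= y -> x + y <= pi ->
  sin (x + y) <= sin x + sin y.
Proof.
move=> x0 y0 xy.
have sx : 0 <= sin x by apply: sin_ge0_pi; rewrite x0; lra.
have sy : 0 <= sin y by apply: sin_ge0_pi; rewrite y0; lra.
have := cos_le1 x; have := cos_le1 y; rewrite sinD; nra.
Qed.

(** Up to pi / 2 the sine increases, so [sin x <= sin y]; beyond, it decreases, so [sin g <= sin y].
    The remaining factor is at most 1. Thus a pull at distance [y] contracts any gap [x] inside
    it. *)
Lemma sin_max_le g x y : 0 <= x -> x <= y -> y <= g -> g <= pi ->
  sin g * sin x <= sin y.
Proof.
move=> x0 xy yg gpi.
have p2 : (0:R) <= pi by exact: pi_ge0.
have sg : 0 <= sin g by apply: sin_ge0_pi; rewrite gpi andbT; lra.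
have sx : 0 <= sin x by apply: sin_ge0_pi; rewrite x0; lra.
have [y2|y2] := leP y (pi / 2).
  have : sin x <= sin y.
    have [->|/eqP nxy] := eqVneq x y; first by [].
    by rewrite ltW// ltr_sin ?in_itv/= ?lt_neqAle; apply/andP; split=> //; lra.
  have := sin_le1 g; nra.
have : sin g <= sin y.
  have -> : sin g = cos (g - pi / 2) by rewrite cosBpihalf.
  have -> : sin y = cos (y - pi / 2) by rewrite cosBpihalf.
  have [->|/eqP nyg] := eqVneq y g; first by [].
  rewrite ltW// ltr_cos ?in_itv/= ?ltrD2r ?lt_neqAle; apply/andP; split=> //; try lra.
have := sin_le1 x; nra.
Qed.

(** Concavity: the mean slopes on [0, x] and [x, g] are values of cos, which decreases on
    [0, pi]. *)
Lemma sin_ge_chord g x : 0 <= x -> x <= g -> g <= pi ->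
  x * sin g <= g * sin x.
Proof.
move=> x0 xg gpi.
have [->|/eqP nx0] := eqVneq x 0; first by rewrite sin0 mul0r mulr0.
have [->|/eqP nxg] := eqVneq x g; first by [].
have {}x0 : 0 < x by lra.
have {}xg : x < g by lra.
have dsin (z : R) : is_derive z 1 sin (cos z) by exact: is_derive_sin.
have csin a b : {within `[a, b], continuous (@sin R)}%classic.
  by apply: continuous_subspaceT => z; exact: continuous_sin.
have [u /[!in_itv]/= /andP[u0 ux]] := MVT x0 (fun z _ => dsin z) (csin _ _).
have [v /[!in_itv]/= /andP[vx vg]] := MVT xg (fun z _ => dsin z) (csin _ _).
rewrite sin0 !subr0 => Ev Eu.
have : cos v < cos u by rewrite ltr_cos ?in_itv/=; [lra| |]; apply/andP; split; lra.
move=> /ltW cvu; have : 0 <= x * (g - x) * (cos u - cos v).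
  by apply: mulr_ge0; [apply: mulr_ge0|]; lra.
have -> : sin g = sin x + cos v * (g - x) by lra.
rewrite Eu; lra.
Qed.

Lemma sin_le_id x : 0 < x -> sin x <= x.
Proof.
move=> x0.
have dsin (z : R) : is_derive z 1 sin (cos z) by exact: is_derive_sin.
have csin : {within `[0, x], continuous (@sin R)}.
  by apply: continuous_subspaceT => z; exact: continuous_sin.
have [u _] := MVT x0 (fun z _ => dsin z) csin.
rewrite sin0 !subr0 => ->; have := cos_le1 u; nra.
Qed.

End Sine.

(** * Weighted drift of sorted phases *)

Section Ladder.
Variable R : realType.

Lemma sin_telescope (y : nat -> R) (k l : nat) :
  (forall m n, (k <= m <= n)%N -> (n <= l)%N -> y m <= y n) ->
  y l - y k <= pi -> (k <= l)%N ->
  sin (y l - y k) <= \sum_(k.+1 <= n < l.+1) sin (y n - y n.-1).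
Proof.
elim: l => [|l IH] mono ypi kl.
  by move: kl; rewrite leqn0 => /eqP ->; rewrite subrr sin0 big_geq.
move: kl; rewrite leq_eqVlt => /predU1P[->|kl].
  by rewrite subrr sin0 big_geq.
rewrite big_nat_recr//=.
have l1 : y l <= y l.+1 by apply: mono => //; lia.
have l2 : y k <= y l by apply: mono => //; lia.
have -> : y l.+1 - y k = (y l - y k) + (y l.+1 - y l) by ring.
apply: le_trans (sinD_le _ _ _) _; [lra|lra|lra|].
rewrite lerD2r; apply: IH => //; last lra.
by move=> m n mn nl; apply: mono => //; lia.
Qed.

Lemma big_ord_itv (V : nmodType) (F : nat -> V) (m p N : nat) : (p <= N)%N ->
  \sum_(i < N | (m <= i < p)%N) F i = \sum_(m <= i < p) F i.
Proof.
move=> pN; rewrite (big_nat_widen _ _ N)// (big_nat_widenl _ 0)// big_mkord.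
by apply: eq_bigl => i; rewrite andbC.
Qed.

(* [y k] is the k-th smallest phase, [dr k] the drift of its owner and [dn k]
   the part of the drift due to neighbors below it. Upward pulls are split into
   gaps between consecutive phases by subadditivity of sin; downward pulls are
   distributed over the gaps by writing [w k] as a telescoping sum. *)
Lemma weighted_drift_le (N : nat) (w y dr dn : nat -> R) (s : R) :
  (forall k l, (k <= l < N)%N -> y k <= y l) ->
  y N.-1 - y 0%N <= pi ->
  0 < s ->
  (forall k, 0 <= w k) ->
  (forall n, (0 < n < N)%N ->
     (N - n)%:R * \sum_(k < n) w k + 1 <= s * (w n - w n.-1)) ->
  (forall k, 0 <= dn k) ->
  (forall k, (k < N)%N ->
     dr k <= \sum_(l < N | (k < l)%N) sin (y l - y k) - dn k) ->
  (forall n, (0 < n < N)%N ->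
     s * sin (y n - y n.-1) <= \sum_(k < N | (n <= k)%N) dn k) ->
  \sum_(k < N) w k * dr k <= - sin (y N.-1 - y 0%N).
Proof.
move=> mono ypi s0 w0 hw dn0 hU hD.
have ypi' m n : (m <= n < N)%N -> y n - y m <= pi.
  move=> mn; have ? : y n <= y N.-1 by apply: mono; lia.
  have ? : y 0%N <= y m by apply: mono; lia.
  lra.
pose g n := sin (y n - y n.-1).
have g0 n : (n < N)%N -> 0 <= g n.
  move=> nN; apply: sin_ge0_pi; rewrite subr_ge0 mono ?ypi'//; lia.
(* Once each pull is split into gaps, gap [n] occurs once for every [l >= n], hence [N - n]
   times. *)
have up k : (k < N)%N ->
    \sum_(l < N | (k < l)%N) sin (y l - y k) <=
    \sum_(n < N | (k < n)%N) (N - n)%:R * g n.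
  move=> kN; apply: (@le_trans _ _
      (\sum_(l < N | (k < l)%N) \sum_(n < N | (k < n <= l)%N) g n)).
    apply: ler_sum => l kl.
    have -> : \sum_(n < N | (k < n <= l)%N) g n = \sum_(k.+1 <= n < l.+1) g n.
      by rewrite -(big_ord_itv g k.+1 (ltn_ord l)).
    apply: sin_telescope; last exact: ltnW.
      by move=> m n mn nl; apply: mono; move: (ltn_ord l); lia.
    by apply: ypi'; move: (ltn_ord l); lia.
  rewrite (exchange_big_dep (fun n : 'I_N => (k < n)%N)) /=; last first.
    by move=> l n _ /andP[].
  apply: ler_sum => n kn.
  rewrite (eq_bigl (fun l : 'I_N => (n <= l < N)%N)) => [|l]; last first.
    by move: (ltn_ord l) kn; lia.
  by rewrite (big_ord_itv (fun=> g n))// sumr_const_nat mulr_natl.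
have wE (k : 'I_N) : w k = w 0%N + \sum_(n < N | (0 < n <= k)%N) (w n - w n.-1).
  rewrite (big_ord_itv (fun n => w n - w n.-1) 1 (ltn_ord k)) big_add1/=.
  by rewrite telescope_sumr// addrC subrK.
have w1 n : (0 < n < N)%N -> 0 <= w n - w n.-1.
  move=> /hw; have : 0 <= \sum_(k < n) w k by exact: sumr_ge0.
  have : (0:R) <= (N - n)%:R by [].
  by nra.
have dnle : \sum_(n < N | (0 < n)%N) (w n - w n.-1) *
     (\sum_(k < N | (n <= k)%N) dn k) <= \sum_(k < N) w k * dn k.
  under eq_bigr => n _ do rewrite mulr_sumr.
  rewrite (exchange_big_dep predT) //=.
  apply: ler_sum => k _; rewrite -mulr_suml ler_wpM2r// wE.
  by rewrite lerDr// w0.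
have uple : \sum_(k < N) w k * \sum_(n < N | (k < n)%N) (N - n)%:R * g n =
   \sum_(n < N | (0 < n)%N) (N - n)%:R * g n * \sum_(k < n) w k.
  under eq_bigr => k _ do rewrite mulr_sumr.
  rewrite (exchange_big_dep (fun n : 'I_N => (0 < n)%N)) /=; last first.
    by move=> k n _; apply: leq_ltn_trans.
  apply: eq_bigr => n _; rewrite (big_ord_widen N w (ltnW (ltn_ord n))) mulr_sumr.
  by apply: eq_bigr => k _; rewrite mulrC.
have tot : \sum_(k < N) w k * dr k <=
    \sum_(k < N) w k * (\sum_(n < N | (k < n)%N) (N - n)%:R * g n) -
    \sum_(k < N) w k * dn k.
  rewrite -sumrB; apply: ler_sum => k _; rewrite -mulrBr ler_wpM2l//.
  by apply: le_trans (hU _ (ltn_ord k)) _; rewrite lerD2r up.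
apply: le_trans tot _.
rewrite uple.
(* The comparison is made gap by gap: [hw] is multiplied by [g n] and [hD] by [w n - w n.-1]. The
   [+ 1] in [hw] leaves one spare copy of every gap. *)
have main : \sum_(n < N | (0 < n)%N) (N - n)%:R * g n * \sum_(k < n) w k
    + \sum_(n < N | (0 < n)%N) g n <=
    \sum_(n < N | (0 < n)%N) (w n - w n.-1) *
     (\sum_(k < N | (n <= k)%N) dn k).
  rewrite -big_split/=; apply: ler_sum => n n0.
  have nN : (0 < n < N)%N by rewrite n0 /=.
  have := hD _ nN; have := hw _ nN; have := w1 _ nN; have := g0 _ (ltn_ord n).
  rewrite -/(g n); move: (\sum_(k < n) w k) (\sum_(k < N | _) dn k) => A B.
  move: (w n - w n.-1) (g n) ((N - n)%:R : R) => u gn M gn0 u0 h1 h2.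
  have : u * (s * gn) <= u * B by rewrite ler_wpM2l.
  have : (M * A + 1) * gn <= s * u * gn by rewrite ler_wpM2r.
  lra.
(* By subadditivity the spare gaps add up to at least the sine of the whole range. *)
suff : sin (y N.-1 - y 0%N) <= \sum_(n < N | (0 < n)%N) g n by lra.
rewrite (eq_bigl (fun n : 'I_N => (0 < n < N)%N)) => [|n]; last first.
  by rewrite ltn_ord andbT.
rewrite (big_ord_itv g 1 (leqnn N)); case: (N) ypi mono => [|M] ypi mono.
  by rewrite subrr sin0 big_geq.
by apply: sin_telescope => // m n mn nM; apply: mono; lia.
Qed.

End Ladder.

(** * Growth of the weights *)

Section Weights.
Variables (R : realType) (N : nat) (eta : R).
Hypothesis eta2 : 2 <= eta.

Let mulr3_ge0 (x y z : R) : 0 <= x -> 0 <= y -> 0 <= z -> 0 <= x * (y * z).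
Proof. by move=> x0 y0 z0; rewrite !mulr_ge0. Qed.

Definition weight (k : nat) : R := eta ^+ k * ((2 * N) ^_ k)%:R.

Lemma weightS k : weight k.+1 = eta * (2 * N - k)%:R * weight k.
Proof. by rewrite /weight exprS ffactnSr natrM; ring. Qed.

Lemma weight_ge0 k : 0 <= weight k.
Proof. by rewrite mulr_ge0// exprn_ge0//; move: eta2; lra. Qed.

Lemma weight_ge1 k : (k <= N)%N -> 1 <= weight k.
Proof.
elim: k => [|k IH] kN; first by rewrite /weight mul1r ffactn0.
have {}IH := IH (ltnW kN); rewrite weightS.
have h : (1 : R) <= (2 * N - k)%:R by rewrite ler1n; lia.
move: eta2 => e2; have : 1 <= eta * (2 * N - k)%:R by nra.
nra.
Qed.

(** The ratio of consecutive weights is [eta * (2 * N - k)], and [k <= N - 2] makes the second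
    factor at least [N + 2]. *)
Lemma weight_step k : (k.+1 < N)%N ->
  eta * N.+2%:R * weight k <= weight k.+1.
Proof.
move=> kN; rewrite weightS ler_wpM2r ?weight_ge0// ler_wpM2l//.
  by move: eta2; lra.
by rewrite ler_nat; lia.
Qed.

Lemma weight_ltS k : (k.+1 < N)%N -> weight k < weight k.+1.
Proof.
move=> kN; have := weight_step kN; have := @weight_ge1 k; rewrite -natr1 -natr1.
have : (0 : R) <= N%:R by [].
move=> N0 /(_ (ltnW (ltnW kN))) w1.
have : 4 * weight k <= eta * (N%:R + 1 + 1) * weight k.
  by rewrite ler_wpM2r ?weight_ge0//; move: eta2; nra.
lra.
Qed.

Lemma weight_lt k l : (k < l < N)%N -> weight k < weight l.
Proof.
elim: l => [|l IH] //; rewrite ltnS => /andP[].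
rewrite leq_eqVlt => /predU1P[->|kl] lN; first exact: weight_ltS.
by apply: lt_trans (weight_ltS lN); apply: IH; rewrite kl ltnW.
Qed.

(** The growth lets the last term dominate: in the induction the previous bound [(N + 1) w_n] is
    absorbed by [w_(n+1)]. *)
Lemma sum_weight_le n : (0 < n <= N)%N ->
  N%:R * \sum_(k < n) weight k <= N.+1%:R * weight n.-1.
Proof.
elim: n => [|[_|n IH]] // nN.
  by rewrite big_ord_recr/= big_ord0 add0r ler_wpM2r ?weight_ge0// ler_nat.
rewrite big_ord_recr/= mulrDr.
have {IH} /= IH := IH _; have nN' : (n.+1 < N)%N by move: nN => /andP[].
have {}IH := IH (ltnW nN').
have := weight_step nN'; have w0 := weight_ge0 n.
move: IH; rewrite -!natr1.
have := ler0n R N; move: (N%:R : R) (\sum_(_ < _) _) => M A M0 IH h.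
have : 0 <= (eta - 1) * ((M + 1 + 1) * weight n).
  by have := eta2 => e2; apply: mulr3_ge0 => //; lra.
lra.
Qed.

(** Write [w_(n+1)] as [eta (N - n) w_n + eta N w_n]: the first part pays for the sum, the second
    for [eta] and for the subtracted [w_n]. Multiplied by [sin gamma], this yields the weight
    condition of [weighted_drift_le]. *)
Lemma weight_ladder n : (0 < n < N)%N ->
  eta * ((N - n)%:R * \sum_(k < n) weight k + 1) <= weight n - weight n.-1.
Proof.
case: n => // n /andP[_ nN] /=.
have := sum_weight_le (n := n.+1) (ltnW nN); rewrite /= => hs.
have w1 := weight_ge1 (ltnW (ltnW nN)).
have : (N - n.+1)%:R * \sum_(k < n.+1) weight k <= (N - n)%:R * weight n.
  have N0 : (0 : R) < N%:R by rewrite ltr0n; lia.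
  rewrite -(ler_pM2l N0) mulrCA.
  apply: le_trans (_ : (N - n.+1)%:R * (N.+1%:R * weight n) <= _).
    by rewrite ler_wpM2l.
  have : ((N - n.+1) * N.+1 <= N * (N - n))%N by nia.
  rewrite -(ler_nat R) !natrM => le_nat.
  by rewrite [leLHS]mulrA [leRHS]mulrA; apply: ler_wpM2r; first exact: weight_ge0.
rewrite weightS.
have -> : (2 * N - n)%:R = (N - n)%:R + N%:R :> R by rewrite -natrD; congr _%:R; lia.
have : (2 : R) <= N%:R by rewrite ler_nat; lia.
have := ler0n R (N - n).
move: (N%:R : R) ((N - n)%:R : R) ((N - n.+1)%:R * _ : R) => M K A K0 M2 hA.
have := eta2 => e2.
have : eta * A <= eta * (K * weight n) by rewrite ler_wpM2l//; lra.
have : 0 <= eta * ((M - 2) * weight n) by apply: mulr3_ge0 => //; lra.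
have : 0 <= eta * (weight n - 1) by apply: mulr_ge0; lra.
have : 0 <= (eta - 1) * weight n by apply: mulr_ge0; lra.
lra.
Qed.

(** The lower ranks together weigh at most twice the rank just below the top, which the top rank
    exceeds by the factor [eta * (N + 2)]. Hence the top rank alone nearly recovers the diameter. *)
Lemma weight_top : eta * \sum_(k < N.-1) weight k <= \sum_(k < N) weight k.
Proof.
case E : N => [|[|n]] /=; first by rewrite !big_ord0 mulr0.
  by rewrite big_ord0 mulr0 big_ord_recr/= big_ord0 add0r weight_ge0.
have nN : (n.+1 < N)%N by rewrite E.
rewrite [leRHS]big_ord_recr/=.
have := sum_weight_le (n := n.+1) (ltnW nN); have := weight_step nN.
have : 0 <= \sum_(k < n.+1) weight k by apply: sumr_ge0 => k _; exact: weight_ge0.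
have : (1 : R) <= N%:R by rewrite ler1n; lia.
have w1 := weight_ge0 n.
rewrite /= -!natr1; move: (N%:R : R) (\sum_(_ < _) _) => M A M1 A0 h1 h2.
have := eta2 => e2.
have : M * A <= M * (2 * weight n).
  by apply: le_trans h2 _; rewrite mulrA ler_wpM2r//; lra.
rewrite ler_pM2l; last by lra.
move=> hA.
have : eta * A <= eta * (2 * weight n) by rewrite ler_wpM2l//; lra.
have : 0 <= eta * (M * weight n) by apply: mulr3_ge0 => //; lra.
lra.
Qed.

(** The 1 is the term [j = 0]; the total weight is thus a factor of the constants in the theorem. *)
Lemma sum_weightE : (0 < N)%N ->
  \sum_(k < N) weight k = \sum_(1 <= j < N) eta ^+ j * ((2 * N) ^_ j)%:R + 1.
Proof.
move=> N0; rewrite -(big_mkord xpredT weight) big_ltn// addrC.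
by rewrite {2}/weight mul1r ffactn0.
Qed.

Lemma sum_weight_ge1 : (0 < N)%N -> 1 <= \sum_(k < N) weight k.
Proof.
move=> N0; rewrite (bigD1 (Ordinal N0))//= {1}/weight mul1r ffactn0 lerDl.
by apply: sumr_ge0 => k _; exact: weight_ge0.
Qed.

End Weights.

(** * First-contact principle for finitely many functions *)

Section Barrier.
Variable R : realType.

Lemma is_derive_lt0_left (h : R -> R) (t dh a : R) :
  is_derive t 1 h dh -> dh < 0 -> a < t ->
  exists2 s, a < s < t & h t < h s.
Proof.
move=> [dbl dE] dh0 at_.
have : (fun e => e^-1 *: (h (e *: 1 + t) - h t)) @ 0^' --> dh by rewrite -dE.
move=> /cvgr_lt /(_ 0 dh0) nh.
have [e /= e0 he] := nh.
pose u := Num.min (e / 2) ((t - a) / 2).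
have u0 : 0 < u by rewrite lt_min; apply/andP; split; lra.
have ue : u <= e / 2 by rewrite ge_min lexx.
have ua : u <= (t - a) / 2 by rewrite ge_min lexx orbT.
exists (t - u); first by apply/andP; split; lra.
have := he (- u); rewrite /ball/= sub0r opprK gtr0_norm// => /(_ _ _).
rewrite oppr_eq0 gt_eqF// => /(_ _ isT).
have ue' : u < e by lra.
move=> /(_ ue').
have -> : - u *: 1 + t = t - u by rewrite [_ *: _]mulr1 addrC.
rewrite invrN scaleNr oppr_lt0 [_ *: _]/(u^-1 * _) pmulr_rgt0 ?invr_gt0//.
by rewrite subr_gt0.
Qed.

(** At the first contact some [h i] vanishes with negative derivative, so it was positive just
    before, a contradiction. Right-continuity at [a] suits an equation that holds only after the
    initial time. *)
Lemma barrier (I : finType) (h dh : I -> R -> R) (a b : R) :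
  (forall i, h i a < 0) ->
  (forall i, h i s @[s --> a^'+] --> h i a) ->
  (forall i t, a < t -> is_derive t 1 (h i) (dh i t)) ->
  (forall t, a < t <= b -> (forall j, h j t <= 0) ->
     forall i, h i t = 0 -> dh i t < 0) ->
  forall t, a <= t <= b -> forall i, h i t < 0.
Proof.
move=> ha hcv hd hdec t /andP[at_ tb] i; rewrite ltNge; apply/negP => hit.
pose E := [set s : R | a <= s /\ exists j, 0 <= h j s].
have Et : E t by split=> //; exists i.
have Elb : lbound E a by move=> s [].
have Ei : has_inf E by split; [exists t|exists a].
pose m := inf E.
have am : a <= m by apply: lb_le_inf => //; exists t.
have mt : m <= t by apply: ge_inf => //; exists a.
have before s j : a <= s -> s < m -> h j s < 0.
  move=> as_ sm; rewrite ltNge; apply/negP => hj.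
  suff : m <= s by rewrite leNgt sm.
  by apply: ge_inf; [exists a | split=> //; exists j].
have right_neg s : a <= s -> (forall j, h j s < 0) ->
    exists2 e, 0 < e & forall u, s < u < s + e -> forall j, h j u < 0.
  move=> as_ hs.
  have : \forall u \near s^'+, forall j, h j u < 0.
    apply: filter_forall => j.
    have : h j u @[u --> s^'+] --> h j s.
      move: as_; rewrite le_eqVlt => /predU1P[<-|as_]; first exact: hcv.
      apply: cvg_at_right_filter.
      have [dd _] := hd j s as_.
      by apply: differentiable_continuous; apply/derivable1_diffP.
    by move=> /cvgr_lt; apply.
  move=> [e /= e0 he]; exists e => // u /andP[su use] j.
  by apply: he => //=; rewrite ltr0_norm; lra.
(* If all functions were negative at [m], they would stay so slightly beyond it, and [m] would not
   be the infimum. *)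
have contact : exists j, 0 <= h j m.
  apply: contrapT => /forallNP nh.
  have hm j : h j m < 0 by rewrite ltNge; apply/negP/nh.
  have [e e0 he] := right_neg _ am hm.
  have [s [as_ [j hj]] sm] := inf_adherent e0 Ei.
  have ms : m <= s by apply: ge_inf; [exists a | split=> //; exists j].
  move: ms; rewrite le_eqVlt => /predU1P[ms|ms].
    by move: hj; rewrite -ms leNgt hm.
  by have := he s; rewrite ms sm => /(_ isT j); rewrite ltNge hj.
have {}am : a < m.
  move: am; rewrite le_eqVlt => /predU1P[am|//].
  by have [j] := contact; rewrite -am leNgt ha.
have cm j : h j u @[u --> m] --> h j m.
  have [dd _] := hd j m am.
  by apply: differentiable_continuous; apply/derivable1_diffP.
have hm j : h j m <= 0.
  have cl : h j u @[u --> m^'-] --> h j m by exact: cvg_at_left_filter.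
  rewrite leNgt; apply/negP => h0.
  near m^'- => u.
  have : h j u < 0.
    by apply: before; near: u; [exact: nbhs_left_ge|exact: nbhs_left_lt].
  by rewrite ltNge => /negP; apply; apply/ltW; near: u; exact: cvgr_gt cl _ h0.
have [j hj] := contact.
have hj0 : h j m = 0 by apply/eqP; rewrite eq_le hm hj.
have mb : a < m <= b by rewrite am (le_trans mt).
have [s /andP[as_ sm]] := is_derive_lt0_left (hd j m am) (hdec m mb hm j hj0) am.
by rewrite hj0 ltNge ltW// before// ltW.
Unshelve. all: by end_near. Qed.

End Barrier.

(** * Clipped assignments and their maximizers *)

Section Clipped.
Variables (N : nat) (a : 'I_N).

(* Assignments of phases to ranks in which only [a] may be repeated: at a
   maximizer of [rank_sum] the phases below that of [a] are replaced by it. *)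
Definition clipped (f : {ffun 'I_N -> 'I_N}) : bool :=
  [forall k, forall l, (f k == f l) ==> (k == l) || (f k == a)].

Lemma clippedP (f : {ffun 'I_N -> 'I_N}) :
  reflect (forall k l, f k = f l -> k = l \/ f k = a) (clipped f).
Proof.
apply: (iffP forallP) => [H k l /eqP kl|H k].
  by move: (H k) => /forallP/(_ l)/implyP/(_ kl)/orP[/eqP|/eqP]; [left|right].
by apply/forallP => l; apply/implyP => /eqP/H[->|->]; rewrite eqxx ?orbT.
Qed.

(** Avoiding [a] forbids every repetition, so [f] is an injection of a finite set into itself. For
    [i = a] this is absurd, so [a] is always attained. *)
Lemma clipped_surj (f : {ffun 'I_N -> 'I_N}) (i : 'I_N) :
  clipped f -> (forall k, f k != a) -> exists k, f k = i.
Proof.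
move=> /clippedP cf fa.
have inj : injective f by move=> k l /cf[//|/eqP]; rewrite (negPf (fa k)).
by exists (invF inj i); rewrite f_invF.
Qed.

Lemma clipped_a f : clipped f -> exists k, f k = a.
Proof.
move=> cf; apply: contrapT => /forallNP fa.
by have [k /fa] := clipped_surj a cf (fun k => introN eqP (fa k)).
Qed.

Variables (R : realType) (w : nat -> R).

Definition rank_sum (x : 'I_N -> R) (f : {ffun 'I_N -> 'I_N}) : R :=
  \sum_(k < N) w k * x (f k).

Section Maximizer.
Hypothesis w_gt0 : forall k, (k < N)%N -> 0 < w k.
Hypothesis w_lt : forall k l, (k < l < N)%N -> w k < w l.
Variables (x : 'I_N -> R) (f : {ffun 'I_N -> 'I_N}).
Hypothesis cf : clipped f.
Hypothesis fmax : forall f', clipped f' -> rank_sum x f' <= rank_sum x f.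

Lemma maximizer_replace k i :
  clipped [ffun l => if l == k then i else f l] -> x i <= x (f k).
Proof.
move=> /fmax; rewrite /rank_sum (bigD1 k)//= [leRHS](bigD1 k)//= ffunE eqxx.
rewrite (eq_bigr (fun l : 'I_N => w l * x (f l))) => [|l /negPf lk]; last first.
  by rewrite ffunE lk.
by rewrite lerD2r ler_pM2l// w_gt0.
Qed.

Lemma maximizer_ge k : x a <= x (f k).
Proof.
apply: maximizer_replace; apply/clippedP => u v; rewrite !ffunE.
have [->|uk] := eqVneq u k; first by right.
by have [_ ->|_] := eqVneq v k; [right|exact: (clippedP _ cf)].
Qed.

(** Rearrangement: exchanging two ranks keeps the assignment clipped, and the higher rank has the
    larger weight. *)
Lemma maximizer_sorted (k l : 'I_N) : (k <= l)%N -> x (f k) <= x (f l).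
Proof.
rewrite leq_eqVlt => /predU1P[/val_inj->//|kl].
have lk : l != k by rewrite -val_eqE/= gtn_eqF.
have kl' : k != l by rewrite eq_sym.
have /fmax : clipped [ffun m => f (tperm k l m)].
  apply/clippedP => u v; rewrite !ffunE => /(clippedP _ cf)[/perm_inj|]; first by left.
  by right.
rewrite /rank_sum (bigD1 k)//= (bigD1 l)//= [leRHS](bigD1 k)//= [X in _ <= _ + X](bigD1 l)//=.
rewrite (eq_bigr (fun l : 'I_N => w l * x (f l))) => [|m /andP[mk ml]]; last first.
  by rewrite ffunE tpermD// eq_sym.
rewrite !ffunE tpermL tpermR !addrA lerD2r.
have := @w_lt k l; rewrite kl ltn_ord => /(_ isT).
by nra.
Qed.

(** Some rank holds [a]; were [i] missed, placing it there would give a better clipped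
    assignment. *)
Lemma maximizer_onto i : x a < x i -> exists k, f k = i.
Proof.
move=> ai; apply: contrapT => /forallNP fi.
have [k fk] := clipped_a cf.
suff : x i <= x (f k) by rewrite fk leNgt ai.
apply: maximizer_replace; apply/clippedP => u v; rewrite !ffunE.
have [->|uk] := eqVneq u k; have [->|vk] := eqVneq v k => //.
- by left.
- by move=> iv; have := fi v; rewrite iv.
- by move=> /fi.
- exact: (clippedP _ cf).
Qed.

Lemma maximizer_bot (k : 'I_N) : val k = 0%N -> x (f k) = x a.
Proof.
move=> k0; apply/eqP; rewrite eq_le maximizer_ge andbT leNgt; apply/negP => ak.
have [l fl] := clipped_a cf.
have : x (f k) <= x (f l) by apply: maximizer_sorted; rewrite k0.
by rewrite fl leNgt ak.
Qed.

End Maximizer.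
End Clipped.

(** * Drift of a maximizer on a digraph with root [a] *)

Section Drift.
Variables (N : nat) (nbr : 'I_N -> {set 'I_N}) (a : 'I_N).
Hypothesis a_root : forall i : 'I_N, i != a ->
  exists2 s : seq 'I_N, path (influences nbr) a s & last a s = i.

(** The arc is the first one by which a path from [a] to [i] enters [U]. *)
Lemma root_cut (U : {set 'I_N}) i : i \in U -> a \notin U ->
  exists u v, [/\ u \in U, v \notin U & v \in nbr u].
Proof.
move=> iU aU.
have ia : i != a by apply: contraNneq aU => <-.
have [s ps ls] := a_root ia.
move: iU; rewrite -ls; elim: s (a) aU ps {ls} => [|b s IH] c cU /=.
  by move=> _; rewrite (negPf cU).
move=> /andP[cb ps] lU; have [bU|bU] := boolP (b \in U); last exact: (IH b).
by exists b, c; split.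
Qed.

Variables (R : realType) (w : nat -> R) (x : 'I_N -> R).
Variables (f : {ffun 'I_N -> 'I_N}) (g : R).
Hypothesis w_ge0 : forall k, 0 <= w k.
Hypothesis w_gt0 : forall k, (k < N)%N -> 0 < w k.
Hypothesis w_lt : forall k l, (k < l < N)%N -> w k < w l.
Hypothesis w_ladder : forall n, (0 < n < N)%N ->
  (N - n)%:R * \sum_(k < n) w k + 1 <= sin g * (w n - w n.-1).
Hypothesis g_gt0 : 0 < g.
Hypothesis g_pi : g < pi.
Hypothesis x_diam : forall i j, x i - x j <= g.
Hypothesis cf : clipped a f.
Hypothesis fmax : forall f', clipped a f' -> rank_sum w x f' <= rank_sum w x f.

(** This reduces to [weighted_drift_le]: the ranked phases run from that of [a], at rank 0, to the
    maximum, at the top rank. *)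
Lemma maximizer_drift : exists2 top, forall i, x i <= x top &
  \sum_(k < N) w k * \sum_(j in nbr (f k)) sin (x j - x (f k)) <=
  - sin (x top - x a).
Proof.
have sorted := maximizer_sorted w_lt cf fmax.
have ge_a := maximizer_ge w_gt0 cf fmax.
have onto := maximizer_onto w_gt0 cf fmax.
(* [weighted_drift_le] indexes by natural numbers; the default [a] only makes [r] total. *)
pose r k : 'I_N := insubd a k.
have rE k : (k < N)%N -> val (r k) = k by move=> kN; rewrite val_insubd kN.
have rK (k : 'I_N) : r k = k by apply: valKd.
pose y k := x (f (r k)).
pose dr k := \sum_(j in nbr (f (r k))) sin (x j - y k).
pose dn k := \sum_(j in nbr (f (r k)) | x j < y k) sin (y k - x j).
have sin0g z : 0 <= z -> z <= g -> 0 <= sin z.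
  by move=> ? ?; apply: sin_ge0_pi; apply/andP; split; move: g_pi; lra.
have sin0x i j : x j <= x i -> 0 <= sin (x i - x j).
  by move=> ji; rewrite sin0g ?subr_ge0.
have ymono k l : (k <= l < N)%N -> y k <= y l.
  by move=> kl; apply: sorted; rewrite !rE; lia.
have sg0 : 0 < sin g by apply: sin_gt0_pi; rewrite g_gt0.
have N0 : (0 < N)%N by apply: leq_ltn_trans (ltn_ord a).
have dn0 k : 0 <= dn k.
  by apply: sumr_ge0 => j /andP[_ jk]; apply/sin0x/ltW.
have hU k : (k < N)%N ->
    dr k <= \sum_(l < N | (k < l)%N) sin (y l - y k) - dn k.
  move=> kN; rewrite lerBrDr /dr (bigID (fun j => x j < y k))/= /dn.
  rewrite addrAC -big_split/= big1 => [|j _]; last first.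
    by rewrite -[x j - _]opprB sinN addNr.
  rewrite add0r.
  apply: (@le_trans _ _ (\sum_(j | y k < x j) sin (x j - y k))).
    rewrite big_mkcond [leRHS]big_mkcond/=; apply: ler_sum => j _.
    case: ltgtP => [_|ykj|->]; rewrite ?andbF ?andbT//.
      by case: ifP => // _; exact/sin0x/ltW.
    by rewrite subrr sin0 if_same.
  (* Vertices above [y k] lie strictly above [a], so each occupies a rank and the sum can pass from
     vertices to ranks. *)
  apply: (@le_trans _ _ (\sum_(l < N | y k < x (f l)) sin (x (f l) - y k))).
    rewrite [leRHS](partition_big f (fun j => y k < x j))//=.
    apply: ler_sum => j kj.
    have [l fl] : exists l, f l = j by apply: onto; apply: le_lt_trans (ge_a _) kj.
    rewrite (bigD1 l)/=; last by rewrite fl kj eqxx.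
    rewrite fl lerDl; apply: sumr_ge0 => m /andP[/andP[km _] _].
    exact/sin0x/ltW.
  rewrite big_mkcond [leRHS]big_mkcond/=; apply: ler_sum => l _.
  have [kl|lk] := ltnP k l.
    rewrite /y rK; case: ltP => // kl'; apply: sin0x.
    by apply: sorted; rewrite rE// ltnW.
  case: ltP => // kl'; move: kl'; rewrite ltNge sorted// rE//.
have hD n : (0 < n < N)%N ->
    sin g * sin (y n - y n.-1) <= \sum_(k < N | (n <= k)%N) dn k.
  move=> /andP[n0 nN].
  have : y n.-1 <= y n by apply: ymono; lia.
  rewrite le_eqVlt => /predU1P[->|lt_y].
    by rewrite subrr sin0 mulr0; apply: sumr_ge0.
  (* The vertices above the lower end of the gap exclude [a], so one of them, [u], has a neighbor
     [v] outside. The pull of [v] on [u] spans the gap. *)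
  have [u [v []]] := @root_cut [set i | y n.-1 < x i] (f (r n))
    ltac:(by rewrite inE) ltac:(by rewrite inE -leNgt ge_a).
  rewrite !inE -leNgt => nu vn vu.
  have [k fk] : exists k, f k = u by apply: onto; apply: le_lt_trans nu; exact: ge_a.
  have nk : (n <= k)%N.
    rewrite leqNgt; apply/negP => kn; move: nu; rewrite -fk ltNge sorted//.
    by rewrite rE; lia.
  have nk' : y n <= x u by rewrite -fk -(rK k); apply: ymono; rewrite nk ltn_ord.
  rewrite (bigD1 k)//= -[leLHS]addr0; apply: lerD; last by apply: sumr_ge0.
  have yk : y k = x u by rewrite /y rK fk.
  rewrite /dn rK fk (bigD1 v)/=; last by rewrite vu yk; lra.
  rewrite -[leLHS]addr0; apply: lerD; last first.
    by apply: sumr_ge0 => j /andP[/andP[_ jk] _]; rewrite yk; apply: sin0x; rewrite -yk ltW.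
  by rewrite yk; apply: sin_max_le => //; [lra|lra|exact: ltW].
have top_lt : (N.-1 < N)%N by rewrite prednK.
exists (f (r N.-1)) => [i|].
  have [ai|] := ltP (x a) (x i); last by move=> /le_trans; apply; exact: ge_a.
  have [k <-] := onto _ ai; apply: sorted; rewrite rE//.
  by move: (ltn_ord k); lia.
have -> : x a = y 0%N.
  by rewrite /y (maximizer_bot w_gt0 w_lt cf fmax)// rE.
have ypi : y N.-1 - y 0%N <= pi by rewrite (le_trans (x_diam _ _))// ltW.
have := weighted_drift_le ymono ypi sg0 w_ge0 w_ladder dn0 hU hD.
apply: le_trans.
rewrite le_eqVlt; apply/orP; left; apply/eqP; apply: eq_bigr => k _.
by rewrite /dr rK; congr (_ * _); apply: eq_bigr => j _; rewrite /y rK.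
Qed.

End Drift.

(** * Attainment of the extreme phases *)

Section Diameter.
Variables (R : realType) (N : nat).
Implicit Types (x : 'I_N -> R) (i : 'I_N).

(** The vertex [i] witnesses that the index set is nonempty, which excludes the default value 0. *)
Lemma vmaxP x i : exists2 j, vmax x = x j & forall k, x k <= x j.
Proof.
rewrite /vmax; case: pickP => [i0 _|/(_ i)//].
have [j xj] : exists j, \big[Num.max/x i0]_(k < N) x k = x j.
  elim/big_ind: _ => [|u v [j ->] [k ->]|k _]; [by exists i0| |by exists k].
  by case: (leP (x j) (x k)) => _; [exists k|exists j].
by exists j => // k; rewrite -xj; exact: le_bigmax.
Qed.

Lemma vminP x i : exists2 j, vmin x = x j & forall k, x j <= x k.
Proof.
rewrite /vmin; case: pickP => [i0 _|/(_ i)//].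
have [j xj] : exists j, \big[Num.min/x i0]_(k < N) x k = x j.
  elim/big_ind: _ => [|u v [j ->] [k ->]|k _]; [by exists i0| |by exists k].
  by case: (leP (x j) (x k)) => _; [exists j|exists k].
by exists j => // k; rewrite -xj; exact: bigmin_le_cond.
Qed.

Lemma diamP x i : exists j k, [/\ diam x = x j - x k,
  forall l, x l <= x j & forall l, x k <= x l].
Proof.
have [j Ej Hj] := vmaxP x i; have [k Ek Hk] := vminP x i.
by exists j, k; rewrite /diam Ej Ek.
Qed.

Lemma sub_le_diam x i j : x i - x j <= diam x.
Proof. by have [k [l [-> Hk Hl]]] := diamP x i; rewrite lerB. Qed.

End Diameter.

(** * Rank sums: linearity, derivatives and comparison with the diameter *)

Section RankSum.
Variables (R : realType) (N : nat) (w : nat -> R).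
Implicit Types (x v : 'I_N -> R) (f : {ffun 'I_N -> 'I_N}).

Lemma rank_sumD x v f :
  rank_sum w (fun i => x i + v i) f = rank_sum w x f + rank_sum w v f.
Proof. by rewrite /rank_sum -big_split; apply: eq_bigr => k _; rewrite mulrDr. Qed.

Lemma rank_sumN x f : rank_sum w (fun i => - x i) f = - rank_sum w x f.
Proof. by rewrite /rank_sum -sumrN; apply: eq_bigr => k _; rewrite mulrN. Qed.

Lemma rank_sumZ c x f : rank_sum w (fun i => c * x i) f = c * rank_sum w x f.
Proof. by rewrite /rank_sum mulr_sumr; apply: eq_bigr => k _; rewrite mulrCA. Qed.

Lemma rank_sum_sub_le x f g : (forall k, 0 <= w k) ->
  rank_sum w x f - rank_sum w x g <= (\sum_(k < N) w k) * diam x.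
Proof.
move=> w0; rewrite /rank_sum -sumrB mulr_suml; apply: ler_sum => k _.
by rewrite -mulrBr ler_wpM2l// sub_le_diam.
Qed.

Lemma is_derive_rank_sum (theta : R -> 'I_N -> R) (t : R) v f :
  (forall i, is_derive t 1 (fun s => theta s i) (v i)) ->
  is_derive t 1 (fun s => rank_sum w (theta s) f) (rank_sum w v f).
Proof.
move=> dv; rewrite /rank_sum; elim: (index_enum _) => [|k l IH].
  rewrite big_nil; under eq_fun do rewrite big_nil; exact: is_derive_cst.
rewrite big_cons; under eq_fun do rewrite big_cons.
by apply: is_deriveD; exact: is_deriveZ.
Qed.

Lemma cvg_rank_sum (theta : R -> 'I_N -> R) (F : set_system R) v f :
  Filter F -> (forall i, theta s i @[s --> F] --> v i) ->
  rank_sum w (theta s) f @[s --> F] --> rank_sum w v f.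
Proof.
move=> FF cv; rewrite /rank_sum; elim: (index_enum _) => [|k l IH].
  rewrite big_nil; under eq_fun do rewrite big_nil; exact: cvg_cst.
rewrite big_cons; under eq_fun do rewrite big_cons.
by apply: cvgD => //; apply: cvgMl_tmp.
Qed.

(* [f] puts a maximizing vertex at the top rank and [a] everywhere else. *)
Lemma rank_sum_diam (a : 'I_N) x (eta : R) : (forall k, 0 <= w k) -> 0 < eta ->
  eta * \sum_(k < N.-1) w k <= \sum_(k < N) w k ->
  exists f g, [/\ clipped a f, clipped a g &
    (1 - 2 / eta) * ((\sum_(k < N) w k) * diam x) <=
    rank_sum w x f - rank_sum w x g].
Proof.
case: (N) a x => [[]//|n] a x /= w0 eta0 htop.
have [u [v [dE Hu Hv]]] := diamP x a.
pose e i := [ffun k : 'I_n.+1 => if val k == n then i else a].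
have ce i : clipped a (e i).
  apply/clippedP => k l; rewrite !ffunE.
  case: eqP => [kN|]; last by right.
  case: eqP => [lN _|_ ->]; last by right.
  by left; apply: val_inj; rewrite kN lN.
exists (e u), (e v); split => //.
have rankE i : rank_sum w x (e i) = (\sum_(k < n) w k) * x a + w n * x i.
  rewrite /rank_sum big_ord_recr/= ffunE eqxx mulr_suml; congr (_ + _).
  by apply: eq_bigr => k _; rewrite ffunE /= ltn_eqF.
rewrite !rankE dE big_ord_recr/=.
move: htop; rewrite big_ord_recr/=.
have : 0 <= \sum_(k < n) w k by exact: sumr_ge0.
move: (\sum_(k < n) w k) => A A0 htop.
(* [e u] and [e v] differ only at the top, so their spread is [w n * diam x]; by [htop] the lower
   weight [A] is at most [(w n + A) / eta]. *)
have : 0 <= (w n + A - eta * A) * (x u - x v) / eta.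
  by rewrite divr_ge0 ?mulr_ge0 ?subr_ge0//; [lra|exact: ltW].
have -> : (w n + A - eta * A) * (x u - x v) / eta =
  (w n + A) * (x u - x v) / eta - A * (x u - x v) by field; lra.
have : 0 <= (w n + A) * (x u - x v) / eta.
  apply: divr_ge0; last exact: ltW.
  by apply: mulr_ge0; [exact: addr_ge0|rewrite subr_ge0].
lra.
Qed.

End RankSum.

(** * Decay of the spread along solutions *)

Section Contraction.
Variables (R : realType) (N : nat) (nbr : 'I_N -> {set 'I_N}).
Variables (Omega : 'I_N -> R) (kappa : R) (theta : R -> 'I_N -> R) (a : 'I_N).
Variables (alpha gamma eta : R).
Hypothesis a_root : forall i : 'I_N, i != a ->
  exists2 s : seq 'I_N, path (influences nbr) a s & last a s = i.
Hypothesis kappa_gt0 : 0 < kappa.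
Hypothesis theta_ode : forall (i : 'I_N) (t : R), 0 < t ->
  is_derive t 1 (fun s : R => theta s i)
    (Omega i + kappa * \sum_(j in nbr i) sin (theta t j - theta t i)).
Hypothesis gamma_gt0 : 0 < gamma.
Hypothesis gamma_pi : gamma < pi.
Hypothesis eta_ge2 : 2 <= eta.
Hypothesis eta_sin : 1 <= eta * sin gamma.
Hypothesis beta_gt0 : 0 < 1 - 2 / eta.
Hypothesis alpha_beta : alpha < (1 - 2 / eta) * gamma.

Let w := weight N eta.
Let W := \sum_(k < N) w k.
Local Notation spread x f g := (rank_sum w x f - rank_sum w x g).
Let force t i : R := \sum_(j in nbr i) sin (theta t j - theta t i).

Let w_ge0 k : 0 <= w k. Proof. exact: weight_ge0. Qed.

Let w_gt0 k : (k < N)%N -> 0 < w k.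
Proof.
by move=> kN; apply: lt_le_trans (weight_ge1 eta_ge2 (ltnW kN)).
Qed.

Let eta_gt0 : 0 < eta. Proof. by have := eta_ge2; lra. Qed.

(* At a contact of the largest spread with the barrier [W * q] both assignments
   are maximizers, for the phases and for their opposites. *)
Lemma spread_force (t q : R) f g : q <= alpha ->
  clipped a f -> clipped a g ->
  (forall f' g', clipped a f' -> clipped a g' -> spread (theta t) f' g' <= W * q) ->
  spread (theta t) f g = W * q ->
  gamma * spread (force t) f g <= - (sin gamma * q).
Proof.
move=> qa cf cg max_le fg.
have W1 : 1 <= W.
  by apply: (sum_weight_ge1 eta_ge2); exact: leq_ltn_trans (ltn_ord a).
set x := theta t in max_le fg *.
have [j [k [dE Hj Hk]]] := diamP x a.
have D0 : 0 <= diam x by rewrite dE subr_ge0.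
have qD : q <= diam x.
  rewrite -(@ler_pM2l _ W); last lra.
  by rewrite -fg; exact: rank_sum_sub_le.
(* With [beta = 1 - 2 / eta], [beta * (W * diam x)] is at most some spread, hence at most [W * q],
   and [q <= alpha < beta * gamma]. *)
have Dg : diam x <= gamma.
  have [f' [g' [cf' cg' h]]] := rank_sum_diam a x w_ge0 eta_gt0 (weight_top N eta_ge2).
  have := le_trans h (max_le _ _ cf' cg').
  rewrite mulrCA ler_pM2l; last exact: lt_le_trans W1.
  move=> hb; rewrite -(ler_pM2l beta_gt0); have := alpha_beta; lra.
have fmax f' : clipped a f' -> rank_sum w x f' <= rank_sum w x f.
  by move=> cf'; have := max_le _ _ cf' cg; rewrite -fg; lra.
have gmax g' : clipped a g' ->
    rank_sum w (fun i => - x i) g' <= rank_sum w (fun i => - x i) g.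
  by move=> cg'; have := max_le _ _ cf cg'; rewrite -fg !rank_sumN; lra.
have sg0 : 0 < sin gamma by apply: sin_gt0_pi; rewrite gamma_gt0.
have ladder n : (0 < n < N)%N ->
    (N - n)%:R * \sum_(k < n) w k + 1 <= sin gamma * (w n - w n.-1).
  move=> nN; have := weight_ladder eta_ge2 nN.
  rewrite -/w; move: (w n - w n.-1) => u.
  have : 0 <= (N - n)%:R * \sum_(k < n) w k by rewrite mulr_ge0// sumr_ge0.
  move: (_ * _ : R) => A A0 h.
  have : sin gamma * (eta * (A + 1)) <= sin gamma * u by rewrite ler_pM2l.
  have : 1 * (A + 1) <= eta * sin gamma * (A + 1) by rewrite ler_wpM2r//; lra.
  lra.
have w_lt m n : (m < n < N)%N -> w m < w n by exact: weight_lt.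
have xg i l : x i - x l <= gamma by rewrite (le_trans (sub_le_diam _ _ _)).
have [u Hu fle] := maximizer_drift a_root w_ge0 w_gt0 w_lt ladder gamma_gt0
  gamma_pi xg cf fmax.
have xg' i l : - x i - - x l <= gamma by rewrite opprK addrC.
have [v Hv gle] := maximizer_drift a_root w_ge0 w_gt0 w_lt ladder gamma_gt0
  gamma_pi xg' cg gmax.
(* The sine is odd, so opposite phases feel the opposite force. *)
have {}gle : - rank_sum w (force t) g <= - sin (x a - x v).
  rewrite -rank_sumN.
  have -> : x a - x v = - x v - - x a by rewrite opprK addrC.
  apply: le_trans gle; rewrite le_eqVlt; apply/orP; left; apply/eqP.
  apply: eq_bigr => l _; congr (_ * _); rewrite /force -sumrN.
  by apply: eq_bigr => m _; rewrite -sinN opprD opprK.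
have Eu : x u = x j by apply/eqP; rewrite eq_le Hj Hu.
have Ev : x v = x k.
  by apply/eqP; rewrite eq_le Hk andbT; have := Hv k; lra.
(* The phase of [a] cuts the range in two: [f] controls the upper part, [g] the lower one. *)
have sD : sin (diam x) <= sin (x u - x a) + sin (x a - x v).
  have -> : diam x = (x u - x a) + (x a - x v) by rewrite dE Eu Ev; ring.
  apply: sinD_le; [by rewrite subr_ge0 Eu|by rewrite subr_ge0 Ev|].
  by rewrite Eu Ev; have := gamma_pi; move: Dg; rewrite dE; lra.
have chord := sin_ge_chord D0 Dg (ltW gamma_pi).
have sq : sin gamma * q <= sin gamma * diam x by rewrite ler_pM2l.
have hs : spread (force t) f g <= - sin (diam x).
  have {}fle : rank_sum w (force t) f <= - sin (x u - x a) by [].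
  lra.
have : gamma * spread (force t) f g <= gamma * - sin (diam x) by rewrite ler_pM2l.
lra.
Qed.

(** At a contact, [spread_force] and the coupling condition make the spread fall faster than the
    level [W * (A - B * t)], whose slope is [- (W * B)]. With [B = 0] the level is fixed. *)
Lemma spread_barrier (s0 b A B : R) : 0 <= s0 ->
  (forall i, theta s i @[s --> s0^'+] --> theta s0 i) ->
  (forall f g, clipped a f -> clipped a g ->
     spread (theta s0) f g < W * (A - B * s0)) ->
  (forall t, s0 < t <= b -> A - B * t <= alpha) ->
  (forall t, s0 < t <= b ->
     gamma * (W * (diam Omega + B)) < kappa * (sin gamma * (A - B * t))) ->
  forall t, s0 <= t <= b -> forall f g, clipped a f -> clipped a g ->
    spread (theta t) f g < W * (A - B * t).
Proof.
move=> s00 cv0 init le_alpha decr t tb f g cf cg.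
(* [barrier] asks for a finite index type; pairs of clipped maps provide it. *)
pose T := {f : {ffun 'I_N -> 'I_N} | clipped a f}.
pose h (p : T * T) t := spread (theta t) (val p.1) (val p.2) - W * (A - B * t).
pose vel t i : R := Omega i + kappa * force t i.
pose dh (p : T * T) t := spread (vel t) (val p.1) (val p.2) + W * B.
suff : h (exist _ f cf, exist _ g cg) t < 0 by rewrite /h /= subr_lt0.
apply: (barrier (a := s0) (b := b) (h := h) (dh := dh)) => //.
- by move=> [[f' cf'] [g' cg']]; rewrite /h subr_lt0/=; exact: init.
- move=> p; apply: cvgB; first by apply: cvgB; exact: cvg_rank_sum.
  apply: cvgMl_tmp; apply: cvgB; first exact: cvg_cst.
  apply: cvgMl_tmp; apply: cvg_at_right_filter; exact: cvg_id.
- move=> p s s0s.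
  have ds i : is_derive s 1 (fun u => theta u i) (vel s i).
    by apply: theta_ode; exact: le_lt_trans s0s.
  have -> : dh p s = rank_sum w (vel s) (val p.1) - rank_sum w (vel s) (val p.2)
      - W *: (0 - B *: 1).
    transitivity (rank_sum w (vel s) (val p.1) - rank_sum w (vel s) (val p.2)
      - W * (0 - B * 1)); last by [].
    by rewrite /dh; ring.
  by apply: is_deriveB; apply: is_deriveB; exact: is_derive_rank_sum.
- move=> s sb hle [[f' cf'] [g' cg']] /eqP; rewrite /h subr_eq0 /= => /eqP h0.
  have max_le f1 g1 : clipped a f1 -> clipped a g1 ->
      spread (theta s) f1 g1 <= W * (A - B * s).
    by move=> c1 c2; have := hle (exist _ f1 c1, exist _ g1 c2); rewrite /h subr_le0.
  have := spread_force (le_alpha s sb) cf' cg' max_le h0.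
  have := decr s sb.
  have -> : dh (exist _ f' cf', exist _ g' cg') s =
      spread Omega f' g' + kappa * spread (force s) f' g' + W * B.
    by rewrite /dh /= !rank_sumD !rank_sumZ; ring.
  have : spread Omega f' g' <= W * diam Omega by exact: rank_sum_sub_le.
  move: (spread Omega _ _) (spread (force s) _ _) (sin gamma * _) => P F S hP d1 d2.
  rewrite -(pmulr_rlt0 _ gamma_gt0).
  have : kappa * (gamma * F) <= kappa * - S by rewrite ler_pM2l.
  have : gamma * P <= gamma * (W * diam Omega) by rewrite ler_pM2l.
  lra.
Qed.

End Contraction.

(** * From the coupling strength to the final bound on the diameter *)

(** [r], [c ^+ d] and the inverse of [beta ^+ d] are all at least 1. This extracts from the coupling
    assumption the bound fed to the contraction; [c] stands for [4 * c] of the theorem. *)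
Lemma coupling_le (R : realType) (r c beta Dinf ct : R) (d : nat) :
  1 <= r -> 1 <= c -> 0 < beta -> beta <= 1 -> 0 < Dinf -> 0 <= ct ->
  ct / (beta * Dinf) <= r * (c ^+ d * ct / (beta ^+ d.+1 * Dinf)).
Proof.
move=> r1 c1 b0 b1 D0 ct0.
have base0 : 0 <= ct / (beta * Dinf) by rewrite divr_ge0// mulr_ge0// ltW.
have -> : c ^+ d * ct / (beta ^+ d.+1 * Dinf) =
    (c ^+ d / beta ^+ d) * (ct / (beta * Dinf)).
  by rewrite exprS; field; rewrite expf_neq0 ?gt_eqF.
rewrite mulrA ler_peMl// mulr_ege1// -expr_div_n exprn_ege1//.
by rewrite ler_pdivlMr// mul1r (le_trans b1).
Qed.

Theorem theorem1p1 (R : realType) (N : nat) (nbr : 'I_N -> {set 'I_N})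
    (Omega : 'I_N -> R) (kappa : R) (theta0 : 'I_N -> R)
    (theta : R -> 'I_N -> R) (alpha gamma eta Dinf : R) (d : nat)
    (spanning : has_spanning_tree nbr)
    (kappa_gt0 : 0 < kappa)
    (sol : kuramoto_solution nbr Omega kappa theta0 theta)
    (alpha_gt : diam (theta 0) < alpha)
    (gamma_gt : alpha < gamma)
    (gamma_lt : gamma < pi)
    (eta_gt : Num.max (1 / sin gamma) (2 / (1 - alpha / gamma)) < eta)
    (hd : last_layer nbr d)
    (Dinf_gt0 : 0 < Dinf)
    (Dinf_lt : Dinf < Num.min alpha (pi / 2)) :
  let beta := 1 - 2 / eta in
  let S := \sum_(1 <= j < N) eta ^+ j * ((2 * N) ^_ j)%:R in
  let c := (2 * N + 1)%:R * (S + 1) * gamma / sin gamma in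
  let ct := diam Omega * (S + 1) * gamma / sin gamma in
  (1 + d.+1%:R * alpha / (alpha - diam (theta 0)))
    * ((4 * c) ^+ d * ct / (beta ^+ d.+1 * Dinf)) < kappa ->
  exists2 tstar : R, 0 <= tstar &
    forall t : R, tstar < t -> diam (theta t) < Dinf.
Proof.
move=> beta S c ct hk.
have [a a_root] := spanning.
have [ode cv0 _] := sol.
have N0 : (0 < N)%N by apply: leq_ltn_trans (ltn_ord a).
have [i0 [i1 [D0E D0j D0k]]] := diamP (theta 0) a.
have D00 : 0 <= diam (theta 0) by rewrite D0E subr_ge0.
have DO0 : 0 <= diam Omega.
  by have [j [k [-> Hj _]]] := diamP Omega a; rewrite subr_ge0.
have alpha0 : 0 < alpha by lra.
have gamma0 : 0 < gamma by lra.
have sg0 : 0 < sin gamma by apply: sin_gt0_pi; rewrite gamma0.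
have ag0 : 0 < alpha / gamma by rewrite divr_gt0.
have ag1 : 0 < 1 - alpha / gamma by rewrite subr_gt0 ltr_pdivrMr ?mul1r.
move: eta_gt; rewrite gt_max => /andP[].
rewrite !ltr_pdivrMr// => eta_sin eta_ag.
have eta0 : 0 < eta by rewrite -(pmulr_lgt0 _ sg0); lra.
have eta2 : 2 < eta.
  have : 0 < eta * (alpha / gamma) by rewrite mulr_gt0.
  lra.
have beta_ag : alpha / gamma < beta.
  rewrite /beta; have : 2 / eta < 1 - alpha / gamma by rewrite ltr_pdivrMr// mulrC.
  lra.
have beta0 : 0 < beta by lra.
have beta1 : beta < 1.
  rewrite /beta; have : 0 < 2 / eta by rewrite divr_gt0.
  lra.
have alpha_beta : alpha < beta * gamma by rewrite -ltr_pdivrMr.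
set W := \sum_(k < N) weight N eta k.
have WE : S + 1 = W by rewrite /W sum_weightE.
have W1 : 1 <= W by exact: (sum_weight_ge1 (ltW eta2) N0).
have W0 : 0 < W by lra.
have coupling : gamma * (W * diam Omega) < kappa * (sin gamma * (beta * Dinf)).
  have r1 : 1 <= 1 + d.+1%:R * alpha / (alpha - diam (theta 0)).
    by rewrite lerDl divr_ge0 ?mulr_ge0//; lra.
  have gs1 : 1 <= gamma / sin gamma.
    by rewrite ler_pdivlMr// mul1r sin_le_id.
  have c1 : 1 <= 4 * c.
    rewrite /c WE; have -> : 4 * ((2 * N + 1)%:R * W * gamma / sin gamma) =
      (4 * (2 * N + 1))%:R * (W * (gamma / sin gamma)) by rewrite natrM; ring.
    by apply: mulr_ege1; [rewrite ler1n addn1 muln_gt0|exact: mulr_ege1].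
  have ct0 : 0 <= ct.
    rewrite /ct WE; apply: divr_ge0; last exact: ltW.
    by apply: mulr_ge0; [apply: mulr_ge0|] => //; exact: ltW.
  have := le_lt_trans (coupling_le d r1 c1 beta0 (ltW beta1) Dinf_gt0 ct0) hk.
  rewrite ltr_pdivrMr ?mulr_gt0// /ct WE ltr_pdivrMr//.
  lra.
set q := beta * Dinf in coupling.
have qa : q < alpha.
  have : Dinf < alpha by move: Dinf_lt; rewrite lt_min => /andP[].
  have : beta * Dinf < 1 * Dinf by rewrite ltr_pM2r.
  by rewrite /q; lra.
(* [gap] is the surplus of the coupling over the frequencies at level [q]. The speed [eps] of the
   barrier spends half of it, which keeps the decrease strict. *)
pose gap := kappa * (sin gamma * q) - gamma * (W * diam Omega).
have gap0 : 0 < gap by rewrite subr_gt0.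
pose eps := gap / (2 * (gamma * W)).
have eps0 : 0 < eps by rewrite divr_gt0 ?mulr_gt0.
have epsE : gamma * (W * eps) = gap / 2.
  by rewrite /eps; field; rewrite !gt_eqF.
(* The time at which the barrier started at [alpha] has come down to [q]. *)
pose b := (alpha - q) / eps.
have b0 : 0 < b by rewrite divr_gt0 ?subr_gt0.
have bE : eps * b = alpha - q by rewrite /b mulrC divfK ?gt_eqF.
have bar := spread_barrier a_root kappa_gt0 ode gamma0 gamma_lt (ltW eta2)
  (ltW eta_sin) beta0 alpha_beta.
(* The barrier descends from [alpha] to [q] on [0, b]; the bound on the initial diameter puts every
   spread below [W * alpha] at time 0. *)
have phase1 f g : clipped a f -> clipped a g ->
    rank_sum (weight N eta) (theta b) f - rank_sum (weight N eta) (theta b) g < W * q.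
  have -> : q = alpha - eps * b by rewrite bE; ring.
  apply: (bar 0 b alpha eps) => //; last by rewrite lexx ltW.
  - move=> f' g' _ _; rewrite mulr0 subr0.
    apply: le_lt_trans (rank_sum_sub_le _ _ _ (weight_ge0 N (ltW eta2))) _.
    by rewrite ltr_pM2l.
  - move=> t /andP[t0 _]; have : 0 < eps * t by rewrite mulr_gt0.
    lra.
  - move=> t /andP[_ tb].
    have : eps * t <= alpha - q by rewrite -bE ler_pM2l.
    move=> et; apply: (@lt_le_trans _ _ (kappa * (sin gamma * q))).
      by rewrite -/W mulrDr mulrDr epsE; move: gap0; rewrite /gap; lra.
    by rewrite ler_pM2l// ler_pM2l//; lra.
exists b => [|t bt]; first exact: ltW.
have [f [g [cf cg hD]]] := rank_sum_diam a (theta t) (weight_ge0 N (ltW eta2)) eta0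
  (weight_top N (ltW eta2)).
(* From [b] on the barrier stays at [q = beta * Dinf]. As this spread is at least
   [beta * (W * diam (theta t))], cancelling [W] and [beta] gives the claim. *)
have : rank_sum (weight N eta) (theta t) f - rank_sum (weight N eta) (theta t) g
    < W * (q - 0 * t).
  apply: (bar b t q 0) => //; [exact: ltW| | | | |by rewrite lexx ltW].
  - move=> i; apply: cvg_at_right_filter; have [dd _] := ode i b b0.
    by apply: differentiable_continuous; apply/derivable1_diffP.
  - by move=> f' g' cf' cg'; rewrite mul0r subr0; exact: phase1.
  - by move=> s _; rewrite mul0r subr0 ltW.
  - by move=> s _; rewrite mul0r subr0 addr0.
move=> /(le_lt_trans hD); rewrite mul0r subr0 -/W /q mulrCA ltr_pM2l//.
by rewrite ltr_pM2l.
Qed.
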